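(* Let $A$ be a commutative unitary ring with $\mathbb{Z}\subset A\subset\mathbb{R}$. Let $\mathsf{s}_1$ and $\mathsf{s}_2$ be two different sections of the exact sequence $1\to A\Phi\to A\Phi\rtimes W\xrightarrow{\pi}W\to1$, given by $\mathsf{s}_1(s_i)=\tau_{x_i}s_i$ and $\mathsf{s}_2(s_i)=\tau_{y_i}s_i$ with $x_i,y_i\in A\Phi$ for $i=1,\dots,n$. Then the following are equivalent: (i) $\mathsf{s}_1$ and $\mathsf{s}_2$ are $A\Phi$-conjugate; (ii) there exists $z\in A\Phi$ such that $x_i-y_i=\langle z,\alpha_i^\vee\rangle\alpha_i$ for every $i=1,\dots,n$.
   Context: $V$ is a Euclidean space with inner product $\langle-,-\rangle$, and $\Phi\subset V$ is an irreducible (reduced) crystallographic root system spanning $V$, with simple system $\Delta=\{\alpha_1,\dots,\alpha_n\}$ and Weyl group $W$, generated by the simple reflections $s_i=s_{\alpha_i}$. For $\alpha\in\Phi$, $\alpha^\vee=2\alpha/\langle\alpha,\alpha\rangle$. $A\Phi$ is the $A$-submodule of $V$ generated by $\Phi$, with its natural $W$-action; $A\Phi\rtimes W$ is the corresponding semidirect product, in which $x\in A\Phi$ is written as the translation $\tau_x$, and $\pi:A\Phi\rtimes W\to W$ is the projection. A section is a group morphism $\mathsf{s}:W\to A\Phi\rtimes W$ with $\pi\circ\mathsf{s}=\mathrm{id}_W$. Two sections $\mathsf{s},\mathsf{s}'$ are $A\Phi$-conjugate if there is $b\in A\Phi$ with $\mathsf{s}'(g)=\tau_b\,\mathsf{s}(g)\,\tau_b^{-1}$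 for all $g\in W$. *)

(* Defs.v *)
From HB Require Import structures.
From mathcomp Require Import all_boot all_order all_algebra.
From mathcomp Require Import finmap all_classical reals.

Set Implicit Arguments.
Unset Strict Implicit.
Unset Printing Implicit Defensive.

Import Order.TTheory GRing.Theory Num.Theory.

Local Open Scope classical_set_scope.
Local Open Scope ring_scope.

Section GeneralLinear.
Variables (R : realType) (V : vectType R).

Record GL := GLElt { glval :> 'End(V); glvalP : lker glval == 0%VS }.

HB.instance Definition _ := [isSub for glval].
HB.instance Definition _ := [Choice of GL by <:].

Fact gl_one_subproof : lker (\1%VF : 'End(V)) == 0%VS.
Proof. by apply/lker0P => u v; rewrite !id_lfunE. Qed.

Fact gl_mul_subproof (f g : GL) : lker (f \o g)%VF == 0%VS.
Proof.
apply/lker0P => u v; rewrite !comp_lfunE => /(lker0P (glvalP f)).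
exact: (lker0P (glvalP g)).
Qed.

Fact gl_inv_subproof (f : GL) : lker (f^-1)%VF == 0%VS.
Proof. exact/lker0P/(can_inj (lker0_lfunVK (glvalP f))). Qed.

Definition gl_one := GLElt gl_one_subproof.
Definition gl_mul (f g : GL) := GLElt (gl_mul_subproof f g).
Definition gl_inv (f : GL) := GLElt (gl_inv_subproof f).

Fact gl_mulA : associative gl_mul.
Proof. by move=> f g h; apply/val_inj/comp_lfunA. Qed.
Fact gl_mul1 : left_id gl_one gl_mul.
Proof. by move=> f; apply/val_inj/comp_lfun1l. Qed.
Fact gl_1mul : right_id gl_one gl_mul.
Proof. by move=> f; apply/val_inj/comp_lfun1r. Qed.
Fact gl_mulV : left_inverse gl_one gl_inv gl_mul.
Proof. by move=> f; apply/val_inj/lker0_compVf/glvalP. Qed.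
Fact gl_Vmul : right_inverse gl_one gl_inv gl_mul.
Proof. by move=> f; apply/val_inj/lker0_compfV/glvalP. Qed.

HB.instance Definition _ :=
  isGroup.Build GL gl_mulA gl_mul1 gl_1mul gl_mulV gl_Vmul.

End GeneralLinear.

Section RootSystems.
Variables (R : realType) (V : vectType R) (ip : {dot V for idfun}).
Implicit Types (a v : V).

Definition coroot a : V := (2 / ip a a) *: a.

Definition reflection_fun a v : V := v - ip v (coroot a) *: a.

Fact reflection_fun_is_linear a : linear (reflection_fun a).
Proof.
move=> k u v; rewrite /reflection_fun linearPl /= scalerBr scalerA scalerDl.
by rewrite opprD addrACA.
Qed.
HB.instance Definition _ a :=
  GRing.isLinear.Build R V V *:%R (reflection_fun a)
    (reflection_fun_is_linear a).

Fact reflection_funK a : involutive (reflection_fun a).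
Proof.
move=> v; have [->|a0] := eqVneq a 0.
  by rewrite /reflection_fun !scaler0 !subr0.
have aa : ip a (coroot a) = 2.
  by rewrite /coroot linearZr /= divfK // gt_eqF // neq0_dnorm_gt0.
rewrite /reflection_fun linearBl /= linearZl_LR /= aa.
by rewrite mulr_natr mulr2n opprD addNKr scaleNr opprK subrK.
Qed.

Fact reflection_subproof a : lker (linfun (reflection_fun a)) == 0%VS.
Proof. by apply/lker0P => u v; rewrite !lfunE => /(can_inj (reflection_funK a)). Qed.

(* For a = 0 this is the identity. *)
Definition reflection a : GL V := GLElt (reflection_subproof a).

(* Reduced crystallographic root system spanning V. *)
Definition root_system_axiom (Phi : {fset V}) : Prop :=
  [/\ <<Phi>>%VS = fullv /\ 0 \notin Phi,
      {in Phi &, forall a b, reflection a b \in Phi},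
      {in Phi, forall a (k : R), k *: a \in Phi -> k = 1 \/ k = -1}
    & {in Phi &, forall a b, ip b (coroot a) \is a Num.int}].

Record root_system :=
  RootSystem { roots :> {fset V}; rootsP : root_system_axiom roots }.

Definition irreducible (Phi : root_system) : Prop :=
  roots Phi <> fset0 /\
  forall P Q : {fset V}, roots Phi = (P `|` Q)%fset ->
    {in P & Q, forall a b, ip a b = 0} -> P = fset0 \/ Q = fset0.

Definition simple_system (Phi : root_system) (n : nat) (alpha : 'I_n -> Phi) :=
  basis_of fullv [seq val (alpha i) | i : 'I_n] /\
  forall b, b \in roots Phi -> exists c : 'I_n -> R,
    b = \sum_(i < n) c i *: val (alpha i) /\
    ((forall i, 0 <= c i) \/ (forall i, c i <= 0)).

Section WeylGroup.
Variable Phi : root_system.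

Definition weyl_pred : {pred GL V} := fun g =>
  `[< smallest (fun S : set (GL V) => group_closed [in S])
        [set reflection a | a in [set` roots Phi]] g >].

Fact weyl_group_closed : group_closed weyl_pred.
Proof.
split=> [|g h /asboolP gW /asboolP hW]; apply/asboolP => S [Sgrp SPhi].
  exact/set_mem/Sgrp.1.
by apply/set_mem/Sgrp.2; apply/mem_set; [apply: gW|apply: hW].
Qed.

Record weyl := WeylElt { weylval :> GL V; weylvalP : weylval \in weyl_pred }.

HB.instance Definition _ := [isSub for weylval].
HB.instance Definition _ := [Choice of weyl by <:].
HB.instance Definition _ :=
  SubChoice_isSubGroup.Build (GL V) weyl_pred weyl weyl_group_closed.

Fact root_reflection_subproof (a : Phi) : reflection (val a) \in weyl_pred.
Proof. by apply/asboolP => S [_]; apply; exists (val a) => //=; apply: valP. Qed.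

Definition root_reflection (a : Phi) : weyl :=
  WeylElt (root_reflection_subproof a).

End WeylGroup.

Section RootModule.
Variables (A : subringClosed R) (Phi : root_system).

Definition submodule (S : set V) : Prop :=
  [/\ S 0, forall u v, S u -> S v -> S (u + v)
    & forall k v, k \in A -> S v -> S (k *: v)].

Definition rootmod_pred : {pred V} := fun v =>
  `[< smallest submodule [set` roots Phi] v >].

Fact rootmod_submodule : submodule rootmod_pred.
Proof.
split=> [|u v /asboolP uM /asboolP vM|k v kA /asboolP vM]; apply/asboolP.
- by move=> S [[]].
- by move=> S SP; case: (SP) => -[_ SD _] _; apply: SD; [apply: uM|apply: vM].
- by move=> S SP; case: (SP) => -[_ _ SZ] _; apply: SZ; last exact: vM.
Qed.

Fact rootmod_zmod_closed : zmod_closed rootmod_pred.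
Proof.
have [M0 MD MZ] := rootmod_submodule; split=> [|u v uM vM]; first exact: M0.
by apply: MD => //; rewrite -scaleN1r; apply: MZ => //; rewrite rpredN1.
Qed.
HB.instance Definition _ :=
  GRing.isZmodClosed.Build V rootmod_pred rootmod_zmod_closed.

Record rootmod :=
  RootmodElt { rootmodval :> V; rootmodvalP : rootmodval \in rootmod_pred }.

HB.instance Definition _ := [isSub for rootmodval].
HB.instance Definition _ := [Choice of rootmod by <:].
HB.instance Definition _ := [SubChoice_isSubZmodule of rootmod by <:].

Fact weyl_act_subproof (g : weyl Phi) (x : rootmod) :
  (g : GL V) (x : V) \in rootmod_pred.
Proof.
have [M0 MD MZ] := rootmod_submodule.
pose S : set (GL V) := fun h => forall a, a \in roots Phi ->
  h a \in roots Phi /\ (h^-1)%g a \in roots Phi.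
have WS : S (g : GL V).
  have /asboolP := weylvalP g; apply; split; last first.
    move=> _ [a /= aPhi <-] b bPhi; have [_ stab _ _] := rootsP Phi.
    have -> : ((reflection a)^-1)%g = reflection a.
      apply: (@mulIg _ (reflection a)); rewrite mulVg; apply/val_inj/lfunP => u.
      by rewrite /= comp_lfunE !lfunE /= reflection_funK.
    by split; apply: stab.
  split=> [|h k /set_mem hS /set_mem kS]; apply/mem_set => a aPhi.
    by rewrite invg1 /= id_lfunE.
  rewrite invgF; split; rewrite /= comp_lfunE.
    by have [_ /hS[]] := kS _ aPhi.
  by have [_ /kS[]] := hS _ aPhi.
have /asboolP := rootmodvalP x.
move/(_ (fun v => (g : GL V) v \in rootmod_pred)); apply; split.
  split=> [|u v uM vM|k v kA vM]; rewrite ?linear0 ?linearD ?linearZ.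
  - exact: M0.
  - exact: MD.
  - exact: MZ.
by move=> a /= /WS[gaPhi _]; apply/asboolP => T [_]; apply.
Qed.

Definition weyl_act (g : weyl Phi) (x : rootmod) : rootmod :=
  RootmodElt (weyl_act_subproof g x).

Fact weyl_act0 g : weyl_act g 0 = 0.
Proof. by apply/val_inj => /=; rewrite linear0. Qed.
Fact weyl_actD g x y : weyl_act g (x + y) = weyl_act g x + weyl_act g y.
Proof. by apply/val_inj => /=; rewrite linearD. Qed.
Fact weyl_act1 x : weyl_act 1%g x = x.
Proof. by apply/val_inj => /=; rewrite id_lfunE. Qed.
Fact weyl_actM g h x : weyl_act (g * h)%g x = weyl_act g (weyl_act h x).
Proof. by apply/val_inj => /=; rewrite comp_lfunE. Qed.

(* The pair (x, g) stands for tau_x g, i.e. for the affine map v |-> g v + x. *)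
Definition semidirect : Type := (rootmod * weyl Phi)%type.

HB.instance Definition _ := Choice.on semidirect.

Definition sd_one : semidirect := (0, 1%g).
Definition sd_mul (p q : semidirect) : semidirect :=
  (p.1 + weyl_act p.2 q.1, (p.2 * q.2)%g).
Definition sd_inv (p : semidirect) : semidirect :=
  (- weyl_act p.2^-1%g p.1, p.2^-1%g).

Fact sd_mulA : associative sd_mul.
Proof.
by move=> p q r; rewrite /sd_mul /= mulgA weyl_actM weyl_actD addrA.
Qed.
Fact sd_mul1 : left_id sd_one sd_mul.
Proof. by case=> x g; rewrite /sd_mul /= weyl_act1 add0r mul1g. Qed.
Fact sd_1mul : right_id sd_one sd_mul.
Proof. by case=> x g; rewrite /sd_mul /= weyl_act0 addr0 mulg1. Qed.
Fact sd_mulV : left_inverse sd_one sd_inv sd_mul.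
Proof. by case=> x g; rewrite /sd_mul /sd_inv /= addNr mulVg. Qed.
Fact sd_Vmul : right_inverse sd_one sd_inv sd_mul.
Proof.
case=> x g; rewrite /sd_mul /sd_inv /= mulgV; congr pair.
apply: (@addIr _ (weyl_act g (weyl_act g^-1%g x))).
by rewrite -addrA -weyl_actD addNr weyl_act0 addr0 add0r -weyl_actM mulgV
  weyl_act1.
Qed.

HB.instance Definition _ :=
  isGroup.Build semidirect sd_mulA sd_mul1 sd_1mul sd_mulV sd_Vmul.

Definition tau (x : rootmod) : semidirect := (x, 1%g).
Definition weyl_incl (g : weyl Phi) : semidirect := (0, g).
Definition sd_proj (p : semidirect) : weyl Phi := p.2.

Definition is_section (s : {multiplicative weyl Phi -> semidirect}) : Prop :=
  forall g, sd_proj (s g) = g.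

Definition rootmod_conjugate
    (s s' : {multiplicative weyl Phi -> semidirect}) : Prop :=
  exists b : rootmod, forall g, s' g = (tau b * s g * (tau b)^-1)%g.

End RootModule.
End RootSystems.

(* Main.v *)
(** A translation [tau b] conjugates [tau x * s_i] into
[tau (x + b - s_i b) * s_i], and [b - s_i b = <b, alpha_i^vee> alpha_i]; so (ii)
with [z = - b] says exactly that [s2] and the [b]-conjugate of [s1] agree on the
simple reflections. Two morphisms agree on a subgroup, so it remains to see that
the simple reflections generate the Weyl group, here defined by all the
reflections. If a positive root [b] is not simple, then [<b, b> > 0] gives a
simple root [alpha_i] with [<b, alpha_i> > 0]; the root [s_i b] is positive of
smaller height, and the reflection in [b] is the [s_i]-conjugate of the one in
[s_i b]. *)
Require Import Defs.
From HB Require Import structures.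
From mathcomp Require Import all_boot all_order all_algebra.
From mathcomp Require Import finmap all_classical reals.

Set Implicit Arguments.
Unset Strict Implicit.
Unset Printing Implicit Defensive.

Import Order.TTheory GRing.Theory Num.Theory.

Local Open Scope ring_scope.

Section Reflections.
Variables (R : realType) (V : vectType R) (ip : {dot V for idfun}).
Implicit Types a b u v : V.

Lemma dotC u v : ip u v = ip v u.
Proof. by rewrite hermC expr0 mul1r. Qed.

Lemma dotZr k u v : ip u (k *: v) = k * ip u v.
Proof. by rewrite dotC linearZl_LR /= dotC. Qed.

Lemma reflectionE a v : reflection ip a v = v - ip v (coroot ip a) *: a.
Proof. by rewrite lfunE. Qed.

Lemma reflectionK a : involutive (reflection ip a).
Proof. by move=> v; rewrite !lfunE /= reflection_funK. Qed.

Lemma dot_coroot v a : ip v (coroot ip a) = 2 / ip a a * ip v a.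
Proof. exact: dotZr. Qed.

Lemma reflectionN a : reflection ip (- a) = reflection ip a.
Proof.
apply/val_inj/lfunP => v; rewrite /= !reflectionE !dot_coroot.
by rewrite linearNl !linearNr opprK mulrN scaleNr scalerN opprK.
Qed.

Lemma reflection_self a : reflection ip a a = - a.
Proof.
have [->|a0] := eqVneq a 0; first by rewrite linear0 oppr0.
have aa : ip a a != 0 by rewrite gt_eqF // neq0_dnorm_gt0.
rewrite reflectionE dot_coroot divfK // scaler_nat mulr2n.
by rewrite opprD addrA subrr sub0r.
Qed.

(** Both sides are [ip u v] minus a term symmetric in [u] and [v], so a reflection is self-adjoint;
    being an involution, it is then an isometry. *)
Lemma dot_reflection a u v :
  ip (reflection ip a u) v = ip u (reflection ip a v).
Proof.
rewrite !reflectionE linearBl linearBr /= linearZl_LR /= !dot_coroot.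
by rewrite dotZr (dotC a v) mulrAC.
Qed.

Lemma reflection_isometry a u v :
  ip (reflection ip a u) (reflection ip a v) = ip u v.
Proof. by rewrite dot_reflection reflectionK. Qed.

(** Conjugating the reflection in [c] by an isometry [g] gives the reflection in [g c]; here [g] is
    the reflection in [a] and [c = g b], so that [g c = b]. *)
Lemma reflection_conjg a b :
  reflection ip b =
  (reflection ip a * reflection ip (reflection ip a b) * reflection ip a)%g.
Proof.
apply/val_inj/lfunP => v; rewrite /= !comp_lfunE.
rewrite (reflectionE (reflection ip a b)) linearB linearZ /= !reflectionK !dot_coroot.
by rewrite !reflection_isometry reflectionE dot_coroot.
Qed.

End Reflections.

Section SimpleGeneration.
Variables (R : realType) (V : vectType R) (ip : {dot V for idfun}).
Variables (Phi : root_system ip) (n : nat) (alpha : 'I_n -> Phi).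
Hypothesis alpha_simple : simple_system alpha.
Implicit Types b d : Phi.

Let X : n.-tuple V := [tuple val (alpha i) | i < n].

Let basisX : basis_of fullv X.
Proof. exact: alpha_simple.1. Qed.

Let freeX : free X.
Proof. exact: basis_free basisX. Qed.

Let nthX (i : 'I_n) : X`_i = val (alpha i).
Proof. by rewrite -tnth_nth tnth_mktuple. Qed.

Let coordE v : v = \sum_i coord X i v *: val (alpha i).
Proof.
rewrite {1}(coord_basis basisX (memvf v)).
by apply: eq_bigr => i _; rewrite nthX.
Qed.

Let coord_alpha i j : coord X j (val (alpha i)) = (j == i)%:R.
Proof. by rewrite -nthX (coord_free _ _ freeX) eq_sym. Qed.

(** Defined on all of [V], so that [- val b] can be tested before it is known to be a root. *)
Let positive v := forall i, 0 <= coord X i v.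

Let height v := \sum_i coord X i v.

Lemma positiveVnegative b : positive (val b) \/ positive (- val b).
Proof.
have [c [bE c0]] := alpha_simple.2 _ (valP b).
have cE i : coord X i (val b) = c i.
  rewrite bE -(coord_sum_free c i freeX); congr (coord _ _ _).
  by apply: eq_bigr => j _; rewrite nthX.
case: c0 => c0; [left|right] => i; rewrite ?linearN /= cE ?oppr_ge0; exact: c0.
Qed.

(** Expanding one argument of [ip b b > 0] in the simple basis gives a positive summand, and its
    coordinate factor is nonnegative. *)
Lemma exists_simple_acute b : positive (val b) ->
  exists2 i, 0 < coord X i (val b) & 0 < ip (val b) (val (alpha i)).
Proof.
move=> b_pos.
have b0 : val b != 0.
  by have [[_ /negP Phi0] _ _ _] := rootsP Phi;
    apply: contra_notN Phi0 => /eqP <-; apply: valP.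
have [i ci0] : exists i, 0 < coord X i (val b) * ip (val b) (val (alpha i)).
  have bb : 0 < ip (val b) (val b) by apply: neq0_dnorm_gt0.
  apply/existsP; apply: contraTT bb.
  rewrite negb_exists -leNgt => /forallP le0.
  rewrite {2}(coordE (val b)) linear_sumr /= sumr_le0 // => i _.
  by rewrite dotZr leNgt.
have ci_gt0 : 0 < coord X i (val b).
  rewrite lt_def b_pos andbT; apply: contraTneq ci0 => ->.
  by rewrite mul0r ltxx.
by exists i => //; rewrite -(pmulr_rgt0 _ ci_gt0).
Qed.

(** The reflection in an acute [alpha i] lowers the [i]-th coordinate by [k > 0] and fixes the
    others. If another coordinate is nonzero, the image is a lower positive root; if none is, [b] is
    a multiple of [alpha i], hence equal to it since the system is reduced. *)
Lemma simple_or_lower b : positive (val b) ->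
  (exists i, b = alpha i) \/
  exists i d, [/\ val d = reflection ip (val (alpha i)) (val b),
                  positive (val d) & height (val d) < height (val b)].
Proof.
move=> b_pos; have [i ci_gt0 bi_gt0] := exists_simple_acute b_pos.
have [_ stab reduced _] := rootsP Phi.
have ai0 : 0 < ip (val (alpha i)) (val (alpha i)).
  apply: neq0_dnorm_gt0; apply: contraTneq bi_gt0 => ->.
  by rewrite linear0r ltxx.
pose k := ip (val b) (coroot ip (val (alpha i))).
have k_gt0 : 0 < k by rewrite /k dot_coroot mulr_gt0 // divr_gt0.
have dPhi := stab _ _ (valP (alpha i)) (valP b).
have dE j : coord X j (reflection ip (val (alpha i)) (val b)) =
    coord X j (val b) - k * (j == i)%:R.
  by rewrite reflectionE linearB linearZ /= coord_alpha.
have [/existsP[j /andP[ji bj]]|] :=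
  boolP [exists j, (j != i) && (coord X j (val b) != 0)].
  right; exists i, [` dPhi]%fset; split=> //=; last first.
    rewrite /height (eq_bigr _ (fun j _ => dE j)) sumrB gtrBl.
    rewrite (bigD1 i) //= eqxx mulr1 big1 ?addr0 // => l /negPf->.
    by rewrite mulr0.
  (* The unchanged positive [j]-th coordinate excludes a negative root. *)
  have [//|/(_ j)] := positiveVnegative [` dPhi]%fset.
  rewrite linearN /= dE (negPf ji) mulr0 subr0 oppr_ge0 leNgt lt_def.
  by rewrite bj b_pos.
rewrite negb_exists => /forallP bj0; left; exists i; apply: val_inj.
have bE : val b = coord X i (val b) *: val (alpha i).
  rewrite {1}(coordE (val b)) (bigD1 i) //= big1 ?addr0 // => j ji.
  by have := bj0 j; rewrite ji negbK => /eqP->; rewrite scale0r.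
have := valP b; rewrite {1}bE => /(reduced _ (valP (alpha i))) [] ci.
  by rewrite bE ci scale1r.
by move: ci_gt0; rewrite ci ltr0N1.
Qed.

Lemma root_reflection_simple_gen (H : {pred weyl Phi}) :
  group_closed H -> (forall i, root_reflection (alpha i) \in H) ->
  forall b, root_reflection b \in H.
Proof.
move=> HG Halpha.
have HM := group_closedM HG.
suff Hpos b : positive (val b) -> root_reflection b \in H.
  move=> b; have [/Hpos //|bN] := positiveVnegative b.
  have [_ stab _ _] := rootsP Phi.
  have NbPhi : - val b \in (Phi : {fset V}).
    by have := stab _ _ (valP b) (valP b); rewrite reflection_self.
  have <- : root_reflection [` NbPhi]%fset = root_reflection b.
    exact/val_inj/reflectionN.
  exact: Hpos.
(* Heights are real numbers here, so the induction runs on the number of roots of smaller height. *)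
have [k] := ubnP #|[pred d : Phi | height (val d) < height (val b)]|.
elim: k b => // k IHk b; rewrite ltnS => le_k /simple_or_lower[[i ->]//|].
move=> [i [d [dE d_pos d_lt]]].
have -> : root_reflection b = (root_reflection (alpha i) *
    root_reflection d * root_reflection (alpha i))%g.
  by apply/val_inj; rewrite /= (reflection_conjg ip (val (alpha i))) dE.
have Hd : root_reflection d \in H.
  apply: IHk => //; apply: leq_trans le_k; apply: proper_card.
  apply/fintype.properP; split; last by exists d; rewrite !inE ?ltxx.
  by apply/fintype.subsetP => e; rewrite !inE => /lt_trans; apply.
by rewrite !HM.
Qed.

(** The Weyl group is a smallest subgroup of [GL V], so minimality is applied to the image [S] of
    [H] in [GL V]. *)
Lemma weyl_simple_gen (H : {pred weyl Phi}) :
  group_closed H -> (forall i, root_reflection (alpha i) \in H) ->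
  forall g, g \in H.
Proof.
move=> HG Halpha g.
have [H1 HF] := HG.
pose S : set (GL V) := fun h => exists2 w, w \in H & val w = h.
have : S (val g).
  have /asboolP := weylvalP g; apply; split; last first.
    move=> _ [a /= aPhi <-]; exists (root_reflection [` aPhi]%fset) => //.
    exact: root_reflection_simple_gen.
  split=> [|h k /set_mem[v vH <-] /set_mem[w wH <-]]; apply/mem_set.
    by exists 1%g.
  by exists (v / w)%g; first exact: HF.
by case=> w wH /val_inj <-.
Qed.

End SimpleGeneration.

(* [gmulfV] needs more structure than [{multiplicative G -> K}] provides. *)
Lemma multiplicativeV (G K : groupType) (f : {multiplicative G -> K}) (g : G) :
  f g^-1%g = (f g)^-1%g.
Proof.
have f1 : f 1%g = 1%g by apply: (@mulIg _ (f 1%g)); rewrite -gmulfM !mul1g.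
by apply: (@mulIg _ (f g)); rewrite -gmulfM !mulVg.
Qed.

Lemma equalizer_group_closed (G K : groupType) (f h : {multiplicative G -> K}) :
  group_closed [pred g | f g == h g].
Proof.
split=> [|u v]; rewrite !inE.
  (* Writing [1] as [1 * 1^-1] makes both images trivial. *)
  by rewrite -(mulgV 1%g) !gmulfM !multiplicativeV !mulgV.
by move=> /eqP fu /eqP fv; rewrite !gmulfM !multiplicativeV fu fv.
Qed.

Lemma tauV (R : realType) (V : vectType R) (ip : {dot V for idfun})
    (A : subringClosed R) (Phi : root_system ip) (b : rootmod A Phi) :
  ((tau b)^-1)%g = tau (- b).
Proof.
apply: (@mulIg _ (tau b)); rewrite mulVg; congr pair; last by rewrite mulg1.
by rewrite /= weyl_act1 addNr.
Qed.

Theorem proposition3p1 (R : realType) (V : vectType R) (ip : {dot V for idfun})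
    (Phi : root_system ip) (Phi_irr : irreducible Phi)
    (n : nat) (alpha : 'I_n -> Phi) (alpha_simple : simple_system alpha)
    (A : subringClosed R)
    (s1 s2 : {multiplicative weyl Phi -> semidirect A Phi})
    (s1_section : is_section s1) (s2_section : is_section s2)
    (s1_neq_s2 : (s1 : weyl Phi -> semidirect A Phi) <> s2)
    (x y : 'I_n -> rootmod A Phi)
    (s1E : forall i, s1 (root_reflection (alpha i)) =
                     (tau (x i) * weyl_incl A (root_reflection (alpha i)))%g)
    (s2E : forall i, s2 (root_reflection (alpha i)) =
                     (tau (y i) * weyl_incl A (root_reflection (alpha i)))%g) :
  rootmod_conjugate s1 s2 <->
  exists z : rootmod A Phi, forall i : 'I_n,
    val (x i) - val (y i) =
      ip (val z) (coroot ip (val (alpha i))) *: val (alpha i).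
Proof.
pose r i := root_reflection (alpha i).
have sectionE (s : weyl Phi -> semidirect A Phi) t i :
    s (r i) = (tau t * weyl_incl A (r i))%g ->
    s (r i) = (t, r i).
  by move=> ->; congr pair; rewrite /= ?weyl_act1 ?addr0 ?mul1g.
(* Moving [tau (- b)] to the left past [r i] turns it into the translation by [- r i b]. *)
have conjE b i : (tau b * s1 (r i) * (tau b)^-1)%g =
    (b + x i - weyl_act (r i) b, r i).
  rewrite tauV (sectionE _ _ _ (s1E i)); congr pair.
    by apply/val_inj => /=; rewrite id_lfunE comp_lfunE id_lfunE linearN.
  by rewrite /= mul1g mulg1.
have conj_simpleP b :
    (forall i, s2 (r i) =
       (tau b * s1 (r i) * (tau b)^-1)%g) <->
    forall i, val (x i) - val (y i) =
      ip (val (- b)) (coroot ip (val (alpha i))) *: val (alpha i).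
  have rE i : val (b + x i - weyl_act (r i) b) =
     val (x i) - ip (val (- b)) (coroot ip (val (alpha i))) *: val (alpha i).
    rewrite /= reflectionE linearNl scaleNr opprK opprB.
    by rewrite (addrC (val b)) -addrA [X in _ + X]addrCA subrr addr0.
  split=> E i; move: (E i).
    rewrite (sectionE _ _ _ (s2E i)) conjE => -[/(congr1 val)].
    by rewrite rE => ->; rewrite subKr.
  move=> xyE; rewrite (sectionE _ _ _ (s2E i)) conjE; congr pair.
  by apply/val_inj; rewrite rE -xyE subKr.
split=> [[b s2_conj]|[z zE]].
  by exists (- b); apply/conj_simpleP => i; apply: s2_conj.
exists (- z).
have simple_eq i : s2 (r i) =
    (tau (- z) * s1 (r i) * (tau (- z))^-1)%g.
  by move: i; apply/conj_simpleP; rewrite opprK.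
(* The conjugate of [s1] is bundled as a morphism, so that its equalizer with [s2] is a subgroup. *)
pose s1z g := (tau (- z) * s1 g * (tau (- z))^-1)%g.
have s1zM : {morph s1z : g h / (g * h)%g}.
  by move=> g h; rewrite /s1z gmulfM -!mulgA mulKg.
pose f : {multiplicative weyl Phi -> semidirect A Phi} :=
  HB.pack s1z (isMultiplicative.Build _ _ s1z s1zM).
move=> g; apply/eqP.
apply: (weyl_simple_gen alpha_simple (equalizer_group_closed s2 f)) => i.
exact/eqP/simple_eq.
Qed.
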